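(* Let $f:\mathbb{R}^m\to\mathbb{R}\cup\{+\infty\}$ be a proper lower semicontinuous convex function such that $\mathrm{bdry}(S_f)\subseteq f^{-1}(0)$. Then the following are equivalent: (i) there exists $\tau\in(0,+\infty)$ such that $\inf\left\{\left|\min_{\|h\|=1}f'(\bar x,h)\right|:\bar x\in\mathrm{bdry}(S_f)\right\}>\tau$ and the following qualification condition (QC) holds: for any sequence $\{z_k\}\subseteq S_f\setminus\mathrm{bdry}(S_f)$ for which there is a sequence $\{x_k\}\subseteq\mathrm{bdry}(S_f)$ with $\lim_{k\to\infty}\frac{f(z_k)-f(x_k)}{\|z_k-x_k\|}=0$, one has $\liminf_{k\to\infty}\left|\min_{\|h\|=1}f'(z_k,h)\right|>\tau$; (ii) there exist constants $c,\varepsilon\in(0,+\infty)$ such that for every proper lsc convex $g:\mathbb{R}^m\to\mathbb{R}\cup\{+\infty\}$ satisfying $\mathrm{bdry}(S_f)\cap g^{-1}(0)\neq\emptyset$ and $\mathrm{Lip}(f-g)<\varepsilon$, one has $\tau_{\min}(g)\le c$; (iii) there exist constants $c,\varepsilon>0$ such that for every $\bar x\in\mathrm{bdry}(S_f)$ and every $u\in\mathbb{R}^m$ with $\|u\|\le1$, one has $\tau_{\min}(g_{u,\varepsilon})\le c$, where $g_{u,\varepsilon}(x):=f(x)+\varepsilon\langle u,x-\bar x\rangle$ for all $x\in\mathbb{R}^m$.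
   Context: $\mathbb{R}^m$ carries the Euclidean norm, $d(x,D)=\inf\{\|x-y\|:y\in D\}$, $\mathrm{bdry}(D)$ is the boundary of $D$. $f'(\bar x,h):=\lim_{t\to0^+}\frac{f(\bar x+th)-f(\bar x)}{t}$ is the directional derivative. For a proper lsc convex $g$, $S_g:=\{x: g(x)\le0\}$ and the global error bound modulus is $\tau_{\min}(g):=\inf\{\tau>0: d(x,S_g)\le\tau[g(x)]_+\ \forall x\in\mathbb{R}^m\}$, where $[t]_+=\max\{t,0\}$ and $\inf\emptyset=+\infty$. For a map $\phi$, $\mathrm{Lip}(\phi):=\sup_{u\neq v}\frac{|\phi(u)-\phi(v)|}{\|u-v\|}$. *)

(* Defs.v *)
From HB Require Import structures.
From mathcomp Require Import all_boot all_order all_algebra.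
From mathcomp Require Import all_classical all_reals all_analysis.
Set Implicit Arguments. Unset Strict Implicit. Unset Printing Implicit Defensive.
Import Order.TTheory GRing.Theory Num.Def Num.Theory.
Import numFieldNormedType.Exports.
Local Open Scope classical_set_scope.
Local Open Scope ring_scope.

Section Defs.
Variables (R : realType) (m : nat).
Local Notation V := 'rV[R]_m.

Definition dotp (u v : V) : R := \sum_(i < m) u ord0 i * v ord0 i.
Definition enorm (x : V) : R := Num.sqrt (dotp x x).

Definition bdry (D : set V) : set V :=
  [set x | forall e : R, 0 < e ->
     (exists y, D y /\ enorm (y - x) < e) /\
     (exists z, ~ D z /\ enorm (z - x) < e)].

Local Open Scope ereal_scope.

Definition sublevel (g : V -> \bar R) : set V := [set x | g x <= 0].
Definition zeroset (g : V -> \bar R) : set V := [set x | g x = 0].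

Definition proper_fun (g : V -> \bar R) : Prop :=
  (forall x, g x != -oo) /\ (exists x, g x != +oo).

Definition lsc_fun (g : V -> \bar R) : Prop :=
  forall (x : V) (a : R), a%:E < g x ->
    exists2 d : R, (0 < d)%R & forall y, (enorm (y - x) < d)%R -> a%:E < g y.

Definition convex_fun (g : V -> \bar R) : Prop :=
  forall (x y : V) (t : R), (0 < t < 1)%R ->
    g (t *: x + (1 - t) *: y)%R <= t%:E * g x + (1 - t)%:E * g y.

Definition proper_lsc_convex (g : V -> \bar R) : Prop :=
  [/\ proper_fun g, lsc_fun g & convex_fun g].

Definition dirder (f : V -> \bar R) (x h : V) : \bar R :=
  lim ((fun t : R => (f (x + t *: h)%R - f x) * (t^-1)%:E) @ at_right 0%R).

(* "min_{||h||=1} f'(x,h)", read as the infimum over the unit sphere *)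
Definition mindir (f : V -> \bar R) (x : V) : \bar R :=
  ereal_inf [set dirder f x h | h in [set h | enorm h = 1%R]].

(* d(x, D), with d(x, empty) = +oo *)
Definition edist (x : V) (D : set V) : \bar R :=
  ereal_inf [set (enorm (x - y)%R)%:E | y in D].

(* global error bound modulus tau_min(g), with inf of empty set = +oo *)
Definition tau_min (g : V -> \bar R) : \bar R :=
  ereal_inf [set t%:E | t in [set t : R | (0 < t)%R /\
     forall x, edist x (sublevel g) <= t%:E * maxe (g x) 0]].

Definition Lip (phi : V -> R) : \bar R :=
  ereal_sup [set (`|phi uv.1 - phi uv.2| / enorm (uv.1 - uv.2))%:E
             | uv in [set uv : V * V | uv.1 != uv.2]].

End Defs.

(* Main.v *)
Require Import Defs.
From HB Require Import structures.
From mathcomp Require Import all_boot all_order all_algebra.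
From mathcomp Require Import all_classical all_reals all_analysis.
From mathcomp Require Import finmap ring lra.
Import Order.TTheory GRing.Theory Num.Def Num.Theory.
Import numFieldNormedType.Exports.
Local Open Scope classical_set_scope.
Local Open Scope ring_scope.

(* Convexity makes [mindir f x] the infimum over [y != x] of the global slopes
   [(f y - f x) / |y - x|], so [mindir f x < - s] only says that some [y]
   satisfies [f y < f x - s |y - x|], a property that survives perturbations of
   Lipschitz constant smaller than [s].

   (i) => (ii): an error bound for a convex [g] follows from uniform descent at
   the zeros [p] of [g].  If [f] is not sharp at [xb], it descends with slope
   [tau] at each such [p]: by its own error bound if [f p > 0], by the first half
   of (i) on the boundary, and by (QC) in the interior, because
   [|f p| <= eps |p - xb|].

   (iii) => (i): if [f x > - eps |x - xb|] for some [x != xb], the tilt by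
   [u = (x - xb) / |x - xb|] is positive at [x], and its error bound produces
   descent of [f] from [x].  This gives (QC).  If [|mindir f xb|] is small at a
   boundary point, minimizing [f + s |. - y0|] for a suitable [y0] near [xb]
   (Ekeland's principle) yields such an [x] without descent of slope [s]. *)

(** * Euclidean norm and its comparison with the sup norm *)

Section EuclideanNorm.
Context {R : realType} {m : nat}.
Implicit Types u v x y : 'rV[R]_m.

Lemma dotpxx_ge0 x : 0 <= dotp x x.
Proof. by apply: sumr_ge0 => i _; rewrite -expr2 sqr_ge0. Qed.

Lemma enorm_ge0 x : 0 <= enorm x. Proof. exact: sqrtr_ge0. Qed.

Lemma enorm_sqr x : enorm x ^+ 2 = dotp x x.
Proof. by rewrite sqr_sqrtr // dotpxx_ge0. Qed.

Lemma dotpC u v : dotp u v = dotp v u.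
Proof. by apply: eq_bigr => i _; rewrite mulrC. Qed.

Lemma dotpDr u x y : dotp u (x + y) = dotp u x + dotp u y.
Proof. by rewrite -big_split; apply: eq_bigr => i _; rewrite mxE mulrDr. Qed.

Lemma dotpZr (a : R) u x : dotp u (a *: x) = a * dotp u x.
Proof. by rewrite mulr_sumr; apply: eq_bigr => i _; rewrite mxE mulrCA. Qed.

Lemma dotpZl (a : R) u x : dotp (a *: u) x = a * dotp u x.
Proof. by rewrite dotpC dotpZr dotpC. Qed.

Lemma enormZ (a : R) x : enorm (a *: x) = `|a| * enorm x.
Proof.
by rewrite /enorm dotpZl dotpZr mulrA -expr2 sqrtrM ?sqr_ge0 // sqrtr_sqr.
Qed.

Lemma enormN x : enorm (- x) = enorm x.
Proof. by rewrite -scaleN1r enormZ normrN1 mul1r. Qed.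

Lemma enormB x y : enorm (x - y) = enorm (y - x).
Proof. by rewrite -opprB enormN. Qed.

Lemma coord_le_enorm x i : `|x ord0 i| <= enorm x.
Proof.
rewrite -sqrtr_sqr ler_wsqrtr // /dotp (bigD1 i) //= -expr2 lerDl.
by apply: sumr_ge0 => j _; rewrite -expr2 sqr_ge0.
Qed.

Lemma enorm_eq0 x : (enorm x == 0) = (x == 0).
Proof.
apply/eqP/eqP => [x0|->]; last by rewrite -(scale0r 0) enormZ normr0 mul0r.
apply/rowP => i; rewrite mxE; apply/eqP; rewrite -normr_le0 -x0.
exact: coord_le_enorm.
Qed.

Lemma enorm0 : enorm (0 : 'rV[R]_m) = 0.
Proof. by apply/eqP; rewrite enorm_eq0. Qed.

Lemma enorm_gt0 x : (0 < enorm x) = (x != 0).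
Proof. by rewrite lt_def enorm_ge0 andbT enorm_eq0. Qed.

Lemma enormB_gt0 x y : (0 < enorm (x - y)) = (x != y).
Proof. by rewrite enorm_gt0 subr_eq0. Qed.

(** Cauchy-Schwarz: the vector [dotp v v *: u - dotp u v *: v] has squared norm [dotp v v] times the
    Gram determinant of [u] and [v]. *)
Lemma dotp_le_enorm u v : dotp u v <= enorm u * enorm v.
Proof.
have [->|v0] := eqVneq v 0.
  by rewrite -(scale0r 0) dotpZr mul0r mulr_ge0 ?enorm_ge0.
rewrite (le_trans (ler_norm _)) // -[leRHS]ger0_norm ?mulr_ge0 ?enorm_ge0 //.
rewrite -!sqrtr_sqr ler_wsqrtr //.
have vv : 0 < dotp v v by rewrite -enorm_sqr exprn_gt0 // enorm_gt0.
have := dotpxx_ge0 (dotp v v *: u + (- dotp u v) *: v).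
rewrite !(dotpDr, dotpZr) 2![dotp (_ + _) _]dotpC !(dotpDr, dotpZr).
rewrite (dotpC v u) exprMn !enorm_sqr => H.
rewrite -subr_ge0 -(pmulr_rge0 _ vv) (le_trans H) // le_eqVlt.
by apply/orP; left; apply/eqP; ring.
Qed.

Lemma norm_dotp_le_enorm u v : `|dotp u v| <= enorm u * enorm v.
Proof.
rewrite ler_norml dotp_le_enorm andbT lerNl -mulN1r -dotpZl scaleN1r.
by rewrite -(enormN u) dotp_le_enorm.
Qed.

Lemma enormD x y : enorm (x + y) <= enorm x + enorm y.
Proof.
rewrite -[leRHS]ger0_norm ?addr_ge0 ?enorm_ge0 // -sqrtr_sqr ler_wsqrtr //.
rewrite sqrrD !enorm_sqr !dotpDr [dotp (_ + _) x]dotpC [dotp (_ + _) y]dotpC.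
rewrite !dotpDr (dotpC y x); have := dotp_le_enorm x y; lra.
Qed.

Lemma enorm_le_add y x z : enorm (x - z) <= enorm (x - y) + enorm (y - z).
Proof. by rewrite -[x in leLHS](subrK y) -addrA enormD. Qed.

(** With [norm_le_enorm], this links [enorm] to the topology of row vectors, which comes from the
    sup norm. *)
Lemma enorm_le_norm x : enorm x <= Num.sqrt m%:R * `|x|.
Proof.
rewrite -[ `|x|]ger0_norm // -sqrtr_sqr -sqrtrM // ler_wsqrtr //.
apply: (@le_trans _ _ (\sum_(i < m) `|x| ^+ 2)); last first.
  by rewrite sumr_const card_ord mulr_natl.
apply: ler_sum => i _; rewrite -expr2 -real_normK ?num_real //.
rewrite lerXn2r ?nnegrE //.
rewrite [leRHS]mx_normrE.
by apply: (le_bigmax _ (fun ij => `|x ij.1 ij.2|) (ord0, i)).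
Qed.

Lemma norm_le_enorm x : `|x| <= enorm x.
Proof.
rewrite [leLHS]mx_normrE; apply: bigmax_le; first exact: enorm_ge0.
by move=> [i j] _ /=; rewrite ord1 coord_le_enorm.
Qed.

End EuclideanNorm.

(** * Existence of minima of lower semicontinuous functions *)

Section LscMin.
Set Implicit Arguments. Unset Strict Implicit.
Context {R : realType} {m : nat}.
Implicit Types F : 'rV[R]_m -> \bar R.

Lemma lsc_open F (a : R) : lsc_fun F -> open [set y | (a%:E < F y)%E].
Proof.
move=> lF; rewrite openE => y /= /lF[d d0 dF].
(* The [+ 1] keeps the divisor positive when [m = 0]. *)
have s0 : 0 < Num.sqrt m%:R + 1 :> R by rewrite ltr_wpDl ?sqrtr_ge0.
apply/nbhs_ballP; exists (d / (Num.sqrt m%:R + 1)); first by rewrite /= divr_gt0.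
move=> z; rewrite -ball_normE /= => zy; apply: dF.
rewrite enormB (le_lt_trans (enorm_le_norm _)) //.
move: zy; rewrite ltr_pdivlMr // => /(le_lt_trans _); apply.
by rewrite mulrC ler_wpM2l // lerDl.
Qed.

Lemma lsc_open_gt F (b : \bar R) : lsc_fun F -> open [set y | (b < F y)%E].
Proof.
case: b => [a|_|lF]; first exact: lsc_open.
- rewrite (_ : [set _ | _] = set0); first exact: open0.
  by rewrite -subset0 => y /=; rewrite ltNge leey.
- rewrite (_ : [set _ | _] = \bigcup_(i : R) [set y | (i%:E < F y)%E]).
    by apply: bigcup_open => i _; exact: lsc_open.
  apply/seteqP; split=> y /=; last by move=> [i _]; apply: lt_trans; rewrite ltNyr.
  case Fy: (F y) => [r| |//] _.
    by exists (r - 1) => //=; rewrite Fy lte_fin ltrBlDr ltrDl.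
  by exists 0 => //=; rewrite Fy ltry.
Qed.

(** Without a minimum, the open sets where [F] exceeds some [F z], with [z] in the compact [K],
    cover [K]. In a finite subcover, the index with the smallest value lies in [K] but in none of
    the sets. *)
Lemma lsc_min F (b : \bar R) (x0 : 'rV[R]_m) (r : R) : lsc_fun F ->
  (F x0 <= b)%E -> (forall y, (F y <= b)%E -> enorm (y - x0) <= r) ->
  exists x, forall y, (F x <= F y)%E.
Proof.
move=> lF x0b br; set K := [set y | (F y <= b)%E].
have cK : compact K.
  apply: bounded_closed_compact.
    exists (r + enorm x0); split; first exact: num_real.
    move=> M rM y /br yr; apply: (le_trans (norm_le_enorm _)).
    rewrite -(subrK x0 y) (le_trans (enormD _ _)) // (le_trans _ (ltW rM)) //.
    by rewrite lerD2r.
  rewrite -openC (_ : ~` K = [set y | (b < F y)%E]); first exact: lsc_open_gt.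
  by rewrite predeqE => y; rewrite /K /= ltNge; split=> /negP.
apply: contrapT => nomin.
have lt_ex z : exists y, (F y < F z)%E.
  apply: contrapT => H; apply: nomin; exists z => y; rewrite leNgt.
  by apply/negP => yz; apply: H; exists y.
move: cK; rewrite compact_cover.
have opU z : K z -> open [set y | (F z < F y)%E] by move=> _; exact: lsc_open_gt.
move=> /(_ _ K (fun z => [set y | (F z < F y)%E]) opU)[].
  move=> y yK; have [z zy] := lt_ex y; exists z => //.
  by rewrite /K /= (le_trans (ltW zy)).
move=> D DK cov; have [z zD _] := cov _ x0b.
have [z0 _ z0min] :=
  arg_minP (P := xpredT) (i0 := [` zD]%fset) (fun i : D => F (val i)) isT.
have /DK : val z0 \in D by exact: valP.
move=> /set_mem/cov[w wD /=].
by rewrite ltNge (z0min [` wD]%fset).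
Qed.

End LscMin.

(** * Convex functions: directional derivatives, projections, error bounds *)

Section Convex.
Set Implicit Arguments. Unset Strict Implicit.
Context {R : realType} {m : nat}.
Implicit Types (f g : 'rV[R]_m -> \bar R) (x y h : 'rV[R]_m).

Lemma convex_le g x y (a b s : R) : convex_fun g -> 0 <= s <= 1 ->
  (g x <= a%:E)%E -> (g y <= b%:E)%E ->
  (g (x + s *: (y - x))%R <= ((1 - s) * a + s * b)%:E)%E.
Proof.
move=> cg /andP[s0 s1] gx gy.
(* [convex_fun] only speaks of [0 < t < 1], so the two endpoints are separate. *)
have [->|sn0] := eqVneq s 0; first by rewrite scale0r addr0 subr0 mul1r mul0r addr0.
have [->|sn1] := eqVneq s 1.
  by rewrite scale1r subrr mul0r add0r mul1r addrCA subrr addr0.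
rewrite (_ : x + _ = s *: y + (1 - s) *: x); last first.
  by rewrite scalerBr scalerBl scale1r addrCA.
apply: (le_trans (cg _ _ _ _)); first by rewrite !lt_neqAle s0 s1 sn1 eq_sym sn0.
by rewrite addeC [leRHS]EFinD !EFinM leeD // lee_wpmul2l // lee_fin subr_ge0.
Qed.

(** By convexity the difference quotient is nondecreasing in [t], so its limit at [0] from the right
    is its infimum over [t > 0]. *)
Lemma dirder_ltP f x h (r a : R) : convex_fun f -> (forall y, f y != -oo%E) ->
  f x = r%:E ->
  (dirder f x h < a%:E)%E <->
  exists2 t : R, 0 < t & (f (x + t *: h)%R < (r + a * t)%:E)%E.
Proof.
move=> cf fNy fx; pose q t := ((f (x + t *: h)%R - f x) * (t^-1)%:E)%E.
have qE t b : f (x + t *: h) = b%:E -> q t = ((b - r) / t)%:E.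
  by rewrite /q fx => ->; rewrite -EFinB -EFinM.
have qy t : 0 < t -> f (x + t *: h) = +oo%E -> q t = +oo%E.
  move=> t0; rewrite /q fx => ->.
  by rewrite addye // gt0_mulye // lte_fin invr_gt0.
have qlt t : 0 < t -> (q t < a%:E)%E <-> (f (x + t *: h)%R < (r + a * t)%:E)%E.
  move=> t0; case E: (f (x + t *: h)) => [b| |].
  - by rewrite (qE _ _ E) !lte_fin ltr_pdivrMr // ltrBlDl.
  - by rewrite (qy _ t0 E).
  - by have := fNy (x + t *: h); rewrite E.
have qmono : {in `]0, +oo[ &, {homo q : s t / s <= t >-> (s <= t)%E}}.
  move=> s t; rewrite !in_itv /= !andbT => s0 t0 st.
  case E: (f (x + t *: h)) => [b| |].
  - rewrite (qE _ _ E).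
    (* The point [x + s *: h] lies at the fraction [s / t] of the segment from [x] to
       [x + t *: h]. *)
    have st1 : 0 <= s / t <= 1.
      by rewrite (divr_ge0 (ltW s0) (ltW t0)) /= ler_pdivrMr // mul1r.
    have := @convex_le f x (x + t *: h) r b (s / t) cf st1.
    rewrite fx E => /(_ (lexx _) (lexx _)).
    rewrite addrAC subrr add0r scalerA divfK ?gt_eqF //.
    case Es: (f (x + s *: h)) => [c| |].
    + rewrite (qE _ _ Es) !lee_fin  ler_pdivrMr // => cb.
      rewrite mulrAC -mulrA; have {}cb : c - r <= s / t * (b - r) by lra.
      by rewrite (le_trans cb) // mulrC.
    + by [].
    + by have := fNy (x + s *: h); rewrite Es.
  - by rewrite (qy _ t0 E) leey.
  - by have := fNy (x + t *: h); rewrite E.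
have -> : dirder f x h = ereal_inf [set q t | t in [set` `]0, +oo[ ] ].
  exact/cvg_lim/nondecreasing_at_right_cvge.
split.
  move=> /ereal_inf_lt[z [t]]; rewrite /= in_itv /= andbT => t0 <- /(qlt _ t0) ?.
  by exists t.
move=> [t t0 /(qlt _ t0) ?]; apply/ereal_inf_ltP.
by exists (q t) => //; exists t; rewrite //= in_itv /= t0.
Qed.

Lemma mindir_ltP f x (r a : R) : convex_fun f -> (forall y, f y != -oo%E) ->
  f x = r%:E ->
  (mindir f x < a%:E)%E <->
  exists2 y, y != x & (f y < (r + a * enorm (y - x))%:E)%E.
Proof.
move=> cf fNy fx; split.
  move=> /ereal_inf_lt[_ [h /= h1 <-]] /(dirder_ltP _ _ cf fNy fx)[t t0 fa].
  exists (x + t *: h); last first.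
    by rewrite addrAC subrr add0r enormZ h1 mulr1 gtr0_norm.
  by rewrite -subr_eq0 addrAC subrr add0r -enorm_gt0 enormZ h1 mulr1 gtr0_norm.
move=> [y yx fy]; have d0 : 0 < enorm (y - x) by rewrite enormB_gt0.
pose h := (enorm (y - x))^-1 *: (y - x).
apply: (@le_lt_trans _ _ (dirder f x h)).
  apply: ereal_inf_lbound; exists h => //=.
  by rewrite enormZ gtr0_norm ?invr_gt0 // mulVf // gt_eqF.
apply/(dirder_ltP _ _ cf fNy fx); exists (enorm (y - x)) => //.
by rewrite scalerA divff ?gt_eqF // scale1r addrC subrK.
Qed.

Lemma mindir_geP f x (r a : R) : convex_fun f -> (forall y, f y != -oo%E) ->
  f x = r%:E ->
  (a%:E <= mindir f x)%E <->
  forall y, ((r + a * enorm (y - x))%:E <= f y)%E.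
Proof.
move=> cf fNy fx; rewrite leNgt; split.
  move=> /negP nlt y; have [->|yx] := eqVneq y x.
    by rewrite subrr enorm0 mulr0 addr0 fx.
  by rewrite leNgt; apply/negP => fy; apply/nlt/(mindir_ltP _ cf fNy fx); exists y.
move=> H; apply/negP => /(mindir_ltP _ cf fNy fx)[y _].
by rewrite ltNge H.
Qed.

(** The distance to [x], set to [+oo] off the sublevel set, is lower semicontinuous, and [lsc_min]
    applies to it. *)
Lemma lsc_proj g x y0 : lsc_fun g -> (g y0 <= 0)%E ->
  exists2 p, (g p <= 0)%E & forall y, (g y <= 0)%E -> enorm (x - p) <= enorm (x - y).
Proof.
move=> lg gy0.
pose F y := if (g y <= 0)%E then (enorm (x - y))%:E else +oo%E.
have lF : lsc_fun F.
  move=> z a; rewrite /F; case: ifPn => [gz|].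
    rewrite lte_fin => az; exists (enorm (x - z) - a); first by rewrite subr_gt0.
    move=> y yz; case: ifPn => [_|_]; last exact: ltry.
    by rewrite lte_fin; have := enorm_le_add y x z; lra.
  rewrite -ltNge => /lg[d d0 dg] _; exists d => // y /dg.
  by rewrite ltNge => /negbTE ->; exact: ltry.
have [] := @lsc_min _ _ F (F y0) y0 (enorm (x - y0) + enorm (x - y0)) lF (lexx _).
  move=> y; rewrite /F gy0; case: ifPn => // _; rewrite lee_fin => yx.
  by rewrite (le_trans (enorm_le_add x _ _)) // lerD // enormB.
move=> p Fp; exists p.
  by have := Fp y0; rewrite /F gy0; case: ifPn.
by move=> y gy; have := Fp y; rewrite /F gy; case: ifPn.
Qed.

(* Moving from [x] towards a point [y] where [g] is negative, convexity puts
   the point at the fraction [a / (a + b)] of the way from [y] in the sublevel set. *)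
Lemma sublevel_segment g x y (a b : R) : convex_fun g -> 0 <= a -> 0 < b ->
  (g y <= (- a)%:E)%E -> (g x <= b%:E)%E ->
  exists2 q, (g q <= 0)%E & (a + b) * enorm (x - q) = b * enorm (x - y).
Proof.
move=> cg a0 b0 gy gx; have ab : 0 < a + b by rewrite ltr_wpDl.
exists (y + (a / (a + b)) *: (x - y)).
  have /le_trans : (g (y + (a / (a + b)) *: (x - y))%R <=
      ((1 - a / (a + b)) * (- a) + a / (a + b) * b)%:E)%E.
    apply: convex_le => //; rewrite (divr_ge0 a0 (ltW ab)) /=.
    by rewrite ler_pdivrMr // mul1r lerDl ltW.
  apply; rewrite lee_fin le_eqVlt; apply/orP; left; apply/eqP.
  by field; rewrite gt_eqF.
rewrite opprD addrA -[X in X - _]scale1r -scalerBl enormZ ger0_norm.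
  by rewrite mulrA; congr (_ * _); field; rewrite gt_eqF.
by rewrite subr_ge0 ler_pdivrMr // mul1r lerDl ltW.
Qed.

(* A nearest point [p] of the sublevel set is a boundary zero of [g];
   joining [x] to a point [y] of steep descent from [p] would produce a closer
   point of the sublevel set if [x] were too far away. *)
Lemma error_bound g (s : R) : convex_fun g -> lsc_fun g ->
  (forall y, g y != -oo%E) -> 0 < s -> (exists y, (g y <= 0)%E) ->
  (forall p, bdry (sublevel g) p -> g p = 0%E ->
     exists2 y, y != p & (g y <= (- (s * enorm (y - p)))%:E)%E) ->
  forall x b, g x = b%:E -> 0 < b ->
  exists2 p, (g p <= 0)%E & s * enorm (x - p) <= b.
Proof.
move=> cg lg gNy s0 [y0 gy0] steep x b gx b0.
have [p gp pmin] := lsc_proj x lg gy0; exists p => //.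
have d0 : 0 < enorm (x - p).
  rewrite enormB_gt0; apply/negP => /eqP xp.
  by move: gp; rewrite -xp gx lee_fin leNgt b0.
(* If [g p < 0], the segment from [p] to [x] would contain a point of the sublevel set closer to
   [x]. *)
have gp0 : g p = 0%E.
  apply/eqP; rewrite eq_le gp leNgt; apply/negP => gplt.
  case E : (g p) gplt => [a| |]; rewrite ?lte_fin //; last first.
    by have := gNy p; rewrite E.
  move=> a0; have := @sublevel_segment g x p (- a) b cg.
  rewrite opprK E gx => /(_ _ b0 (lexx _) (lexx _))[|q /pmin pq]; first lra.
  have : 0 < (- a) * enorm (x - q).
    by rewrite mulr_gt0 ?oppr_gt0 // (lt_le_trans d0).
  have : b * enorm (x - p) <= b * enorm (x - q) by rewrite ler_pM2l.
  by lra.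
have [] := steep p _ gp0.
  move=> e e0; split; first by exists p; rewrite /sublevel /= gp0 subrr enorm0.
  (* Moving from [p] towards [x] leaves the sublevel set at once, by minimality of [p]; [l] keeps
     the point within [e] of [p]. *)
  pose l := Num.min 1 (e / (2 * enorm (x - p))).
  have l0 : 0 < l by rewrite lt_min ltr01 divr_gt0 // mulr_gt0.
  have l1 : l <= 1 by rewrite ge_min lexx.
  have le : l * enorm (x - p) < e.
    apply: (@le_lt_trans _ _ (e / 2)); last lra.
    rewrite -ler_pdivlMr // ge_min; apply/orP; right.
    by rewrite le_eqVlt; apply/orP; left; apply/eqP; field; rewrite gt_eqF.
  exists (p + l *: (x - p)); split.
    move=> /pmin.
    rewrite (_ : x - (p + _) = (1 - l) *: (x - p)); last first.
      by rewrite scalerBl scale1r opprD addrA.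
    rewrite enormZ ger0_norm ?subr_ge0 // leNgt => /negP; apply.
    by rewrite mulrBl mul1r ltrBlDr ltrDl mulr_gt0.
  by rewrite addrAC subrr add0r enormZ gtr0_norm.
move=> y yp gy; have t0 : 0 < enorm (y - p) by rewrite enormB_gt0.
have st0 := mulr_gt0 s0 t0.
have [||q /pmin pq eq] := @sublevel_segment g x y (s * enorm (y - p)) b cg _ b0 gy _.
- exact: ltW.
- by rewrite gx.
(* With [t] for [enorm (y - p)], minimality of [p] and the triangle inequality give
   [(s t + b) |x - p| <= b (|x - p| + t)]; cancelling [b |x - p|] and then [t] gives the claim. *)
rewrite -(ler_pM2r t0).
have : (s * enorm (y - p) + b) * enorm (x - p) <= b * (enorm (x - p) + enorm (y - p)).
  apply: (@le_trans _ _ (b * enorm (x - y))); last first.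
    by rewrite ler_pM2l // [enorm (y - p)]enormB (enorm_le_add p).
  by rewrite -eq ler_pM2l // addr_gt0.
lra.
Qed.

End Convex.

(** * The error bound modulus and perturbations by Lipschitz or affine terms *)

Section Stability.
Set Implicit Arguments. Unset Strict Implicit.
Context {R : realType} {m : nat}.
Implicit Types (f g : 'rV[R]_m -> \bar R) (x y z u p : 'rV[R]_m).

(** Only finite positive values need testing: the distance vanishes where [g x <= 0], and the bound
    is infinite where [g x = +oo]. *)
Lemma tau_min_le g (c : R) : 0 < c ->
  (forall x b, g x = b%:E -> 0 < b ->
     exists2 p, (g p <= 0)%E & enorm (x - p) <= c * b) ->
  (tau_min g <= c%:E)%E.
Proof.
move=> c0 H; apply: ereal_inf_lbound; exists c => //; split=> // x.
have [gx|gx] := leP (g x) 0%E.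
  rewrite mule0; apply: ereal_inf_lbound; exists x => //.
  by rewrite subrr enorm0.
case E : (g x) gx => [b| |//] gx; last by rewrite gt0_muley ?lte_fin // leey.
have [p gp xp] := H _ _ E gx.
by apply: (@le_trans _ _ (enorm (x - p))%:E) => //; apply: ereal_inf_lbound; exists p.
Qed.

(** The strict inequality supplies an actual constant below [c] and then an actual point [p],
    without any infimum being attained. *)
Lemma tau_min_lt g (c : R) : (tau_min g < c%:E)%E ->
  forall x b, g x = b%:E -> 0 < b ->
     exists2 p, (g p <= 0)%E & enorm (x - p) < c * b.
Proof.
move=> /ereal_inf_lt[_ [t /= [t0 H] <-]]; rewrite lte_fin => tc x b gx b0.
have : (Defs.edist x (sublevel g) < (c * b)%:E)%E.
  apply: (le_lt_trans (H x)); rewrite gx max_l ?lee_fin ?ltW //.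
  by rewrite -EFinM lte_fin ltr_pM2r.
by move=> /ereal_inf_lt[_ [p gp <-]] xp; exists p.
Qed.

Lemma lsc_add f (l : 'rV[R]_m -> R) (e : R) : 0 < e ->
  (forall x y, `|l y - l x| <= e * enorm (y - x)) -> lsc_fun f ->
  lsc_fun (fun x => f x + (l x)%:E)%E.
Proof.
move=> e0 ll lf x a ax.
(* Half of the gap is kept to absorb the variation of [l]; at [f x = +oo] any margin works. *)
have [d d0 dax] : exists2 d : R, 0 < d & ((a - l x + d)%:E < f x)%E.
  case: (f x) ax => [r| |//]; last by exists 1; rewrite ?ltry.
  rewrite -EFinD lte_fin => ax; exists ((r + l x - a) / 2); first lra.
  by rewrite lte_fin; lra.
have [d1 d10 H] := lf _ _ dax.
exists (Num.min d1 (d / e)); first by rewrite lt_min d10 divr_gt0.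
move=> y; rewrite lt_min => /andP[/H fy].
rewrite ltr_pdivlMr // => yx.
have := ll x y; rewrite ler_norml => /andP[ly _].
case: (f y) fy => [r| |//]; last by rewrite addye ?ltry.
by rewrite -EFinD !lte_fin => fy; lra.
Qed.

Lemma convex_add f (l : 'rV[R]_m -> R) :
  (forall x y (t : R), l (t *: x + (1 - t) *: y) = t * l x + (1 - t) * l y) ->
  convex_fun f -> convex_fun (fun x => f x + (l x)%:E)%E.
Proof.
move=> ll cf x y t t01; rewrite ll.
rewrite muleDr //; last by rewrite fin_num_adde_defl.
rewrite [((1 - t)%:E * _)%E]muleDr //; last by rewrite fin_num_adde_defl.
by rewrite addeACA -!EFinM -EFinD leeD2r // cf.
Qed.

Lemma tilt_lipschitz u xb (e : R) x y : 0 < e -> enorm u <= 1 ->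
  `|e * dotp u (y - xb) - e * dotp u (x - xb)| <= e * enorm (y - x).
Proof.
move=> e0 u1; rewrite -mulrBr normrM gtr0_norm // ler_pM2l //.
rewrite (_ : dotp _ _ - _ = dotp u (y - x)); last first.
  by rewrite -mulN1r -dotpZr -dotpDr scaleN1r opprB addrA subrK.
by rewrite (le_trans (norm_dotp_le_enorm _ _)) // ler_piMl ?enorm_ge0.
Qed.

Lemma proper_lsc_convex_tilt f u xb (e : R) : 0 < e -> enorm u <= 1 ->
  proper_lsc_convex f ->
  proper_lsc_convex (fun x => f x + (e * dotp u (x - xb))%:E)%E.
Proof.
move=> e0 u1 [[fNy [x0 fx0]] lf cf]; split.
- split=> [x|]; last by exists x0; case: (f x0) fx0.
  by have := fNy x; case: (f x).
- by apply: (lsc_add e0 _ lf) => x y; exact: tilt_lipschitz.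
- apply: convex_add cf => x y t.
  rewrite [t * _]mulrCA [(1 - t) * _]mulrCA -mulrDr.
  rewrite -(dotpZr t) -(dotpZr (1 - t)) -dotpDr.
  congr (_ * dotp _ _); rewrite !scalerBr addrACA -opprD -scalerDl.
  by rewrite addrCA subrr addr0 scale1r.
Qed.

(** For [a = mindir f x] the two cases are linear growth away from [x] and descent from [x]. *)
Lemma lt_abseP (a : \bar R) (t : R) :
  (t%:E < `|a|)%E -> (t%:E <= a)%E \/ (a < (- t)%:E)%E.
Proof.
case: a => [a| |] /=; rewrite ?lte_fin ?lee_fin ?leey ?ltNyr; [|by left|by right].
by rewrite lter_normr => /orP[/ltW|]; [left|right; rewrite ltrNr].
Qed.

Lemma le_abse_lt (a : \bar R) (t : R) : (a < (- t)%:E)%E -> (t%:E <= `|a|)%E.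
Proof.
case: a => [a| |//] /=; rewrite ?leey // lte_fin lee_fin => H.
by rewrite ler_normr; apply/orP; right; lra.
Qed.

End Stability.

(** * From slope bounds to stability: (i) implies (ii) *)

Section Main.
Set Implicit Arguments. Unset Strict Implicit.
Context {R : realType} {m : nat}.
Variable f : 'rV[R]_m -> \bar R.
Hypothesis f_plc : proper_lsc_convex f.
Hypothesis f_bdry : bdry (sublevel f) `<=` zeroset f.
Implicit Types (g : 'rV[R]_m -> \bar R) (x y z u p : 'rV[R]_m).

Let fNy x : f x != -oo%E. Proof. by case: f_plc => -[]. Qed.
Let lf : lsc_fun f. Proof. by case: f_plc. Qed.
Let cf : convex_fun f. Proof. by case: f_plc. Qed.

(** The real [a] stands for the value [f x], known to be finite wherever this is used. *)
Definition steep (s : R) x (a : R) :=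
  exists2 y, y != x & (f y < (a - s * enorm (y - x))%:E)%E.

Lemma mindir_lt_steep s x a : f x = a%:E ->
  (mindir f x < (- s)%:E)%E <-> steep s x a.
Proof.
by move=> fx; rewrite (mindir_ltP (- s) cf fNy fx); split=> -[y yx fy]; exists y;
  rewrite // ?mulNr // -mulNr.
Qed.

(** Turns the sequential (QC) into one uniform constant: counterexamples for constants tending to
    [0] would form a sequence that (QC) forbids. *)
Lemma interior_steep (tau : R) : 0 < tau ->
  (forall z : nat -> 'rV[R]_m,
     (forall k, (sublevel f `\` bdry (sublevel f)) (z k)) ->
     (exists x : nat -> 'rV[R]_m,
        (forall k, bdry (sublevel f) (x k)) /\
        ((fun k => (f (z k) - f (x k)) * ((enorm (z k - x k)%R)^-1)%:E)%E
           @ \oo --> 0%:E)) ->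
     (tau%:E < limn_einf (fun k => `|mindir f (z k)|))%E) ->
  exists2 e : R, 0 < e & forall z x a, (sublevel f `\` bdry (sublevel f)) z ->
    bdry (sublevel f) x -> f z = a%:E -> - a <= e * enorm (z - x) ->
    steep tau z a.
Proof.
move=> tau0 QC; apply: contrapT => noe.
(* Starting at [2] makes [e k < tau] for every [k], including [k = 0]. *)
pose e k : R := tau / k.+2%:R.
have e0 k : 0 < e k by rewrite divr_gt0.
have bad k : exists zx : 'rV[R]_m * 'rV[R]_m,
    [/\ (sublevel f `\` bdry (sublevel f)) zx.1, bdry (sublevel f) zx.2 &
      exists a, [/\ f zx.1 = a%:E, - a <= e k * enorm (zx.1 - zx.2) & ~ steep tau zx.1 a]].
  apply: contrapT => H; apply: noe; exists (e k) => // z x a Sz bx fz az.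
  by apply: contrapT => ns; apply: H; exists (z, x); split=> //; exists a.
have [zx zxP] := choice bad.
have : (tau%:E < limn_einf (fun k => `|mindir f (zx k).1|))%E.
  apply: QC => [k|]; first by have [] := zxP k.
  exists (fun k => (zx k).2); split=> [k|]; first by have [] := zxP k.
  pose q k : R := fine (f (zx k).1) / enorm ((zx k).1 - (zx k).2).
  rewrite (_ : (fun k => _) = EFin \o q); last first.
    apply/funext => k; have [_ /f_bdry fx [a [fz _ _]]] := zxP k.
    by rewrite /q /= fz fx sube0 -EFinM.
  apply: cvg_EFin; first by near=> k.
  (* The quotient lies between [- e k] and [0], since [f] vanishes at the boundary point and is
     nonpositive at the interior one. *)
  apply: (@squeeze_cvgr _ _ _ _ (fun k => - e k) (fun=> 0)) => //; last 2 first.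
  - rewrite -oppr0; apply: cvgN; rewrite -(mulr0 tau); apply: cvgMr.
    have := @cvg_harmonic R; rewrite -cvg_shiftS; exact.
  - exact: cvg_cst.
  near=> k; have [[Sz nbz] bx [a [fz az _]]] := zxP k.
  have d0 : 0 < enorm ((zx k).1 - (zx k).2).
    by rewrite enormB_gt0; apply/negP => /eqP E; apply: nbz; rewrite E.
  rewrite /q /= fz /= ler_pdivlMr // ler_pdivrMr // mul0r mulNr lerNl az /=.
  by move: Sz; rewrite /sublevel /= fz lee_fin.
rewrite ltNge => /negP; apply; rewrite limn_einf_lim; apply: lime_le.
  exact: is_cvg_einfs.
near=> k; apply: (@le_trans _ _ `|mindir f (zx k).1|%E).
  by apply: ereal_inf_lbound; exists k => /=.
have [[Sz nbz] bx [a [fz az ns]]] := zxP k.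
(* Descent is excluded by the choice of the sequence. Growth at rate [tau] would force [f > 0] at
   the boundary point, as [e k < tau]. *)
rewrite leNgt; apply/negP => /lt_abseP[|/(mindir_lt_steep tau fz)//].
move=> /(mindir_geP tau cf fNy fz) /(_ (zx k).2).
rewrite (f_bdry bx) lee_fin enormB.
have d0 : 0 < enorm ((zx k).1 - (zx k).2).
  by rewrite enormB_gt0; apply/negP => /eqP E; apply: nbz; rewrite E.
have : e k * enorm ((zx k).1 - (zx k).2) < tau * enorm ((zx k).1 - (zx k).2).
  by rewrite ltr_pM2r // ltr_pdivrMr // ltr_pMr // ltr1n.
lra.
Unshelve. all: by end_near.
Qed.

(** The perturbation costs at most half of the slope [tau], whence the constant [2 / tau]; the bound
    by [e] serves to apply (QC) at interior zeros of [g]. *)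
Lemma stable_of_slope (tau e : R) : 0 < tau -> 0 < e ->
  (tau%:E < ereal_inf [set `|mindir f xb| | xb in bdry (sublevel f)])%E ->
  (forall z x a, (sublevel f `\` bdry (sublevel f)) z ->
    bdry (sublevel f) x -> f z = a%:E -> - a <= e * enorm (z - x) ->
    steep tau z a) ->
  forall g xb (phi : 'rV[R]_m -> R), proper_lsc_convex g ->
    bdry (sublevel f) xb -> g xb = 0%E -> (forall x, f x = (g x + (phi x)%:E)%E) ->
    (forall x y, `|phi x - phi y| <= Num.min e (tau / 2) * enorm (x - y)) ->
    (tau_min g <= (2 / tau)%:E)%E.
Proof.
move=> tau0 e0 inft steep_int g xb phi [[gNy _] lg cg] bxb gxb fE Lphi.
have mindirP x : bdry (sublevel f) x ->
    (tau%:E <= mindir f x)%E \/ (mindir f x < (- tau)%:E)%E.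
  move=> bx; apply: lt_abseP; apply: (lt_le_trans inft).
  by apply: ereal_inf_lbound; exists x.
have phixb : phi xb = 0.
  by have := fE xb; rewrite (f_bdry bxb) gxb add0e => -[].
have phiL x y : [/\ phi x - phi y <= e * enorm (x - y),
    phi y - phi x <= e * enorm (x - y),
    phi x - phi y <= tau / 2 * enorm (x - y) &
    phi y - phi x <= tau / 2 * enorm (x - y)].
  have := Lphi x y; rewrite ler_norml => /andP[h1 h2].
  have m1 : Num.min e (tau / 2) * enorm (x - y) <= e * enorm (x - y).
    by rewrite ler_wpM2r ?enorm_ge0 // ge_min lexx.
  have m2 : Num.min e (tau / 2) * enorm (x - y) <= tau / 2 * enorm (x - y).
    by rewrite ler_wpM2r ?enorm_ge0 // ge_min lexx orbT.
  by split; lra.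
apply: tau_min_le => [|x b gx b0]; first by rewrite divr_gt0.
suff [p gp px] : exists2 p, (g p <= 0)%E & tau / 2 * enorm (x - p) <= b.
  exists p => //; rewrite -(ler_pM2l tau0).
  by rewrite (_ : tau * (2 / tau * b) = 2 * b); [lra | field; rewrite gt_eqF].
(* If [f] grows at rate [tau] from [xb], then [g] grows at rate [tau / 2], and [xb] itself is the
   required point. *)
case: (mindirP _ bxb) => [/(mindir_geP _ cf fNy (f_bdry bxb)) sharp|].
  exists xb; first by rewrite gxb.
  have := sharp x; rewrite fE gx -EFinD lee_fin add0r => h.
  by have [_ _ h1 _] := phiL x xb; move: h1; rewrite phixb; lra.
move=> /(mindir_lt_steep _ (f_bdry bxb))[y0 _ fy0].
(* Since [f y0 < 0], no boundary point can have growth in all directions, so descent holds at each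
   of them. *)
have bdry_steep p : bdry (sublevel f) p -> steep tau p 0.
  move=> bp; apply/(mindir_lt_steep _ (f_bdry bp)).
  case: (mindirP _ bp) => // /(mindir_geP _ cf fNy (f_bdry bp)) /(_ y0).
  move=> /le_lt_trans/(_ fy0); rewrite lte_fin => h; exfalso; move: h.
  have := mulr_ge0 (ltW tau0) (enorm_ge0 (y0 - p)).
  have := mulr_ge0 (ltW tau0) (enorm_ge0 (y0 - xb)).
  lra.
have f_eb := error_bound cf lf fNy tau0.
apply: (error_bound cg lg gNy _ _ _ gx b0); first by rewrite divr_gt0.
  by exists xb; rewrite gxb.
move=> p _ gp; have fp : f p = (phi p)%:E by rewrite fE gp add0e.
have [y yp fy] : exists2 y, y != p & (f y <= (phi p - tau * enorm (y - p))%:E)%E.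
  (* Outside the sublevel set of [f], the error bound of [f] gives [q] with
     [f q <= 0 <= f p - tau * enorm (q - p)]. *)
  have [a0|a0] := ltP 0 (phi p).
    have [||q fq pq] := f_eb _ _ p _ fp a0.
    - by exists xb; rewrite (f_bdry bxb).
    - move=> z bz _; have [y yz fy] := bdry_steep _ bz.
      by exists y => //; rewrite -[- _]add0r ltW.
    exists q; first by apply/negP => /eqP E; move: fq; rewrite E fp lee_fin leNgt a0.
    by apply: (le_trans fq); rewrite lee_fin enormB; lra.
  have [bp|nbp] := pselect (bdry (sublevel f) p).
    have [y yp fy] := bdry_steep _ bp; exists y => //.
    have -> : phi p = 0 by have := f_bdry bp; rewrite /zeroset /= fp => -[].
    exact: ltW.
  have [||y yp fy] := steep_int p xb (phi p) _ bxb fp.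
  - by split=> //; rewrite /sublevel /= fp lee_fin.
  - by have [_ + _ _] := phiL p xb; rewrite phixb sub0r.
  by exists y => //; exact: ltW.
exists y => //; move: fy; rewrite fE.
(* Passing from [f] to [g] loses at most [tau / 2] of the slope. *)
have [_ _ _ yp_phi] := phiL y p.
case: (g y) => [r| |]; rewrite ?leNye ?addye //.
by rewrite -EFinD !lee_fin => fy; lra.
Qed.

(** * From stability under tilts to slope bounds: (iii) implies (i) *)

Section Converse.
Variables c eps : R.
Hypothesis c0 : 0 < c.
Hypothesis eps0 : 0 < eps.
Hypothesis tilt : forall xb u, bdry (sublevel f) xb -> enorm u <= 1 ->
  (tau_min (fun x => f x + (eps * dotp u (x - xb))%:E)%E <= c%:E)%E.

(** The bound [2 * s <= eps] makes the tilting vector admissible; [2 * s <= (4 * c)^-1] leaves a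
    descent of slope [s] after the error bound is used with constant [2 * c]. *)
Let s := Num.min eps (4 * c)^-1 / 2.

Let s0 : 0 < s.
Proof. by rewrite divr_gt0 // lt_min eps0 invr_gt0 mulr_gt0. Qed.

(* Tilting by [u] in the direction of [x - xb] makes the perturbed function
   positive at [x], so that its error bound forces a descent of [f] from [x]. *)
Lemma steep_of_tilt xb x a : bdry (sublevel f) xb -> x != xb -> f x = a%:E ->
  - a < s * 2 * enorm (x - xb) -> steep s x a.
Proof.
move=> bxb xxb fx ax; have d0 : 0 < enorm (x - xb) by rewrite enormB_gt0.
(* Scaled so that [eps *: u] has norm [2 * s]. *)
pose u := (s * 2 / eps / enorm (x - xb)) *: (x - xb).
have s20 : 0 < s * 2 by rewrite mulr_gt0.
have seps : s * 2 <= eps by rewrite divfK // ge_min lexx.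
have sc : s * 2 <= (4 * c)^-1 by rewrite divfK // ge_min lexx orbT.
have k0 : 0 <= s * 2 / eps / enorm (x - xb).
  by rewrite ltW // !divr_gt0.
have u1 : enorm u <= 1.
  rewrite enormZ ger0_norm // divfK ?gt_eqF //.
  by rewrite ler_pdivrMr // mul1r.
have epsu y : eps * dotp u y = s * 2 / enorm (x - xb) * dotp (x - xb) y.
  by rewrite dotpZl; field; rewrite !gt_eqF //.
have gx : eps * dotp u (x - xb) = s * 2 * enorm (x - xb).
  by rewrite epsu -enorm_sqr; field; rewrite gt_eqF.
(* Doubling [c] gives the strict inequality that [tau_min_lt] requires. *)
have c2 : (c%:E < (2 * c)%:E)%E by rewrite lte_fin ltr_pMl // ltr1n.
have := tau_min_lt (le_lt_trans (tilt bxb u1) c2).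
move=> /(_ x (a + s * 2 * enorm (x - xb))).
rewrite fx gx -EFinD => /(_ erefl)[|p]; first lra.
case E : (f p) => [b| |]; rewrite ?addye //; last by have := fNy p; rewrite E.
rewrite -EFinD lee_fin => gp xp.
have xp2 : s * 2 * enorm (x - p) <= (a + s * 2 * enorm (x - xb)) / 2.
  have : (4 * c)^-1 * enorm (x - p) <= (a + s * 2 * enorm (x - xb)) / 2.
    rewrite mulrC ler_pdivrMr ?mulr_gt0 //; apply: (le_trans (ltW xp)).
    by rewrite le_eqVlt; apply/orP; left; apply/eqP; field.
  by apply: le_trans; rewrite ler_wpM2r ?enorm_ge0.
have up : eps * dotp u (x - p) <= s * 2 * enorm (x - p).
  rewrite epsu mulrAC ler_pdivrMr // -[leRHS]mulrA ler_pM2l //.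
  by rewrite mulrC dotp_le_enorm.
have uD : eps * dotp u (p - xb) = s * 2 * enorm (x - xb) - eps * dotp u (x - p).
  rewrite -gx -mulrBr; congr (_ * _).
  by apply/eqP; rewrite eq_sym subr_eq -dotpDr (addrC (p - xb)) addrA subrK.
have sp := mulr_ge0 (ltW s0) (enorm_ge0 (x - p)).
have px : p != x.
  apply/negP => /eqP px; move: gp E; rewrite px gx fx => gp [ab].
  have : 0 < a + s * 2 * enorm (x - xb) by lra.
  by rewrite ltNge ab gp.
exists p => //; rewrite E lte_fin enormB; lra.
Qed.

(** A smaller value gives [f] a slow decrease from [xb] and a point [y0] of slow increase. The
    minimizer of [F] below stays away from [xb], and [steep_of_tilt] there contradicts
    minimality. *)
Lemma bdry_slope xb : bdry (sublevel f) xb -> ((s / 7)%:E <= `|mindir f xb|)%E.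
Proof.
move=> bxb; have fxb := f_bdry bxb; have t0 : 0 < s / 7 by rewrite divr_gt0.
rewrite leNgt; apply/negP => small.
have lower y : ((- (s / 7 * enorm (y - xb)))%:E <= f y)%E.
  have /(mindir_geP _ cf fNy fxb)/(_ y) : ((- (s / 7))%:E <= mindir f xb)%E.
    by rewrite leNgt; apply/negP => /le_abse_lt; rewrite leNgt small.
  by rewrite add0r mulNr.
have [y0 y0xb] : exists2 y, y != xb & (f y < (0 + 2 * (s / 7) * enorm (y - xb))%:E)%E.
  apply/(mindir_ltP _ cf fNy fxb); apply: (le_lt_trans (lee_abs _)).
  by apply: (lt_trans small); rewrite lte_fin ltr_pMl // ltr1n.
rewrite add0r => fy0; have d0 : 0 < enorm (y0 - xb) by rewrite enormB_gt0.
pose F y := (f y + (s * enorm (y - y0))%:E)%E.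
have lF : lsc_fun F.
  apply: (lsc_add s0 _ lf) => x y; rewrite -mulrBr normrM gtr0_norm // ler_pM2l //.
  have := enorm_le_add x y y0; have := enorm_le_add y x y0.
  by rewrite (enormB x y) ler_norml; lra.
(* The [7] yields the radius: with [d = enorm (y0 - xb)] and [r = enorm (y - y0)],
   [s r <= 2 s d / 7 + s (r + d) / 7] means [r <= d / 2]. *)
have near_y0 y : (F y <= (2 * (s / 7) * enorm (y0 - xb))%:E)%E ->
    enorm (y - y0) <= enorm (y0 - xb) / 2.
  rewrite /F; case: (f y) (lower y) => [r| |//]; rewrite ?addye //.
  rewrite -EFinD !lee_fin => low up; rewrite -(ler_pM2l s0).
  have : s * enorm (y - xb) <= s * (enorm (y - y0) + enorm (y0 - xb)).
    by rewrite ler_pM2l // enorm_le_add.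
  lra.
have Fy0 : (F y0 <= (2 * (s / 7) * enorm (y0 - xb))%:E)%E.
  by rewrite /F subrr enorm0 mulr0 adde0 ltW.
have [x Fx] := lsc_min lF Fy0 near_y0.
have xy0 := near_y0 _ (le_trans (Fx y0) Fy0).
have dx : enorm (y0 - xb) / 2 <= enorm (x - xb).
  by have := enorm_le_add x y0 xb; rewrite (enormB y0 x); lra.
have dx0 : 0 < enorm (x - xb) by rewrite (lt_le_trans _ dx) // divr_gt0.
have xxb : x != xb by rewrite -enormB_gt0.
case E : (f x) => [a| |]; last by have := fNy x; rewrite E.
  have sdx := mulr_gt0 s0 dx0.
  have [|y yx fy] := steep_of_tilt bxb xxb E.
    by have := lower x; rewrite E lee_fin; lra.
  have := Fx y; rewrite /F E -EFinD.
  have : s * enorm (y - y0) <= s * (enorm (y - x) + enorm (x - y0)).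
    by rewrite ler_pM2l // enorm_le_add.
  case: (f y) fy => [r| |//] //; rewrite -EFinD !lee_fin lte_fin; lra.
by have := le_trans (Fx y0) Fy0; rewrite /F E addye.
Qed.

(** Once the quotient exceeds [- s], [steep_of_tilt] gives slope [s] at [z k]; this bounds all late
    tail infima. *)
Lemma interior_slope (z : nat -> 'rV[R]_m) :
  (forall k, (sublevel f `\` bdry (sublevel f)) (z k)) ->
  (exists x : nat -> 'rV[R]_m,
     (forall k, bdry (sublevel f) (x k)) /\
     ((fun k => (f (z k) - f (x k)) * ((enorm (z k - x k)%R)^-1)%:E)%E
        @ \oo --> 0%:E)) ->
  (s%:E <= limn_einf (fun k => `|mindir f (z k)|))%E.
Proof.
move=> zP [x [bx qcvg]]; rewrite limn_einf_lim; apply: lime_ge.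
  exact: is_cvg_einfs.
have [N _ HN] : \forall k \near \oo, (s%:E <= `|mindir f (z k)|)%E.
  have : \forall k \near \oo,
      ((- s)%:E < (f (z k) - f (x k)) * ((enorm (z k - x k)%R)^-1)%:E)%E.
    apply: (qcvg [set y | ((- s)%:E < y)%E]); apply: open_nbhs_nbhs.
    by split; [exact: open_ereal_gt_ereal | rewrite /= lte_fin oppr_lt0].
  apply: filterS => k; have [Sz nbz] := zP k.
  have zx : z k != x k by apply/negP => /eqP E; apply: nbz; rewrite E.
  have d0 : 0 < enorm (z k - x k) by rewrite enormB_gt0.
  move: Sz; rewrite /sublevel /=.
  case E : (f (z k)) => [a| |] //; last by have := fNy (z k); rewrite E.
  rewrite (f_bdry (bx k)) sube0 -EFinM lte_fin => _.
  rewrite ltr_pdivlMr // => az; apply/le_abse_lt/(mindir_lt_steep _ E).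
  apply: (steep_of_tilt (bx k) zx E).
  have := mulr_gt0 s0 d0; lra.
exists N => // n Nn; apply: le_ereal_inf_tmp => _ [k /= nk <-].
by apply: HN; exact: leq_trans nk.
Qed.

Lemma slope_of_tilt : exists2 tau : R, 0 < tau &
  (tau%:E < ereal_inf [set `|mindir f xb| | xb in bdry (sublevel f)])%E /\
  (forall z : nat -> 'rV[R]_m,
     (forall k, (sublevel f `\` bdry (sublevel f)) (z k)) ->
     (exists x : nat -> 'rV[R]_m,
        (forall k, bdry (sublevel f) (x k)) /\
        ((fun k => (f (z k) - f (x k)) * ((enorm (z k - x k)%R)^-1)%:E)%E
           @ \oo --> 0%:E)) ->
     (tau%:E < limn_einf (fun k => `|mindir f (z k)|))%E).
Proof.
have t7 : ((s / 8)%:E < (s / 7)%:E)%E by rewrite lte_fin; have := s0; lra.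
(* Smaller than both [s / 7] and [s], because (i) asks for strict inequalities. *)
exists (s / 8); first by rewrite divr_gt0.
split.
  apply: (lt_le_trans t7); apply: le_ereal_inf_tmp => _ [xb bxb <-].
  exact: bdry_slope.
move=> z zP xP; apply: (lt_le_trans _ (interior_slope zP xP)).
by rewrite lte_fin; have := s0; lra.
Qed.

End Converse.
End Main.

(** * The cycle of implications *)

Local Open Scope ereal_scope.

Theorem theorem9 (R : realType) (m : nat) (f : 'rV[R]_m -> \bar R) :
  proper_lsc_convex f ->
  bdry (sublevel f) `<=` zeroset f ->
  let cond_i :=
    exists2 tau : R, (0 < tau)%R &
      tau%:E < ereal_inf [set `|mindir f xb| | xb in bdry (sublevel f)] /\
      (forall z : nat -> 'rV[R]_m,
         (forall k, (sublevel f `\` bdry (sublevel f)) (z k)) ->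
         (exists x : nat -> 'rV[R]_m,
            (forall k, bdry (sublevel f) (x k)) /\
            ((fun k => (f (z k) - f (x k)) * ((enorm (z k - x k)%R)^-1)%:E)
               @ \oo --> 0%:E)) ->
         tau%:E < limn_einf (fun k => `|mindir f (z k)|)) in
  let cond_ii :=
    exists c eps : R, [/\ (0 < c)%R, (0 < eps)%R &
      forall g : 'rV[R]_m -> \bar R,
        proper_lsc_convex g ->
        bdry (sublevel f) `&` zeroset g !=set0 ->
        (exists phi : 'rV[R]_m -> R,
           (forall x, f x = g x + (phi x)%:E) /\ Lip phi < eps%:E) ->
        tau_min g <= c%:E] in
  let cond_iii :=
    exists c eps : R, [/\ (0 < c)%R, (0 < eps)%R &
      forall (xb u : 'rV[R]_m), bdry (sublevel f) xb -> (enorm u <= 1)%R ->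
        tau_min (fun x => f x + (eps * dotp u (x - xb))%:E) <= c%:E] in
  (cond_i <-> cond_ii) /\ (cond_ii <-> cond_iii).
Proof.
move=> f_plc f_bdry cond_i cond_ii cond_iii.
have i_ii : cond_i -> cond_ii.
  move=> [tau tau0 [inft QC]].
  have [e e0 steep_int] := interior_steep f_plc f_bdry tau0 QC.
  exists (2 / tau)%R, (Num.min e (tau / 2))%R; split.
  - by rewrite divr_gt0.
  - by rewrite lt_min e0 divr_gt0.
  move=> g g_plc [xb [bxb gxb]] [phi [fE Lphi]].
  apply: (stable_of_slope f_plc f_bdry tau0 e0 inft steep_int g_plc bxb gxb fE).
  (* [Lip] only ranges over distinct pairs. *)
  move=> x y; have [->|xy] := eqVneq x y.
    by rewrite !subrr normr0 enorm0 mulr0.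
  rewrite -ler_pdivrMr ?enormB_gt0 // -lee_fin (le_trans _ (ltW Lphi)) //.
  by apply: ereal_sup_ubound; exists (x, y).
have ii_iii : cond_ii -> cond_iii.
  (* A tilt of size [eps / 2] has Lipschitz constant strictly below [eps]. *)
  move=> [c [eps [c0 eps0 H]]]; exists c, (eps / 2)%R; split=> //.
    by rewrite divr_gt0.
  have e0 : (0 < eps / 2)%R by rewrite divr_gt0.
  move=> xb u bxb u1; apply: H.
  - exact: proper_lsc_convex_tilt.
  - exists xb; split=> //; rewrite /zeroset /= (f_bdry _ bxb) subrr.
    by rewrite -(scale0r 0) dotpZr mul0r mulr0 add0e.
  - exists (fun x => - (eps / 2 * dotp u (x - xb)))%R; split=> [x|].
      by rewrite -addeA -EFinD subrr adde0.
    apply: (@le_lt_trans _ _ (eps / 2)%:E); last by rewrite lte_fin; lra.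
    apply: ge_ereal_sup => _ [[x y] /= xy <-].
    rewrite lee_fin ler_pdivrMr ?enormB_gt0 // -opprD normrN.
    exact: tilt_lipschitz.
have iii_i : cond_iii -> cond_i.
  by move=> [c [eps [c0 eps0 H]]]; exact: slope_of_tilt c0 eps0 H.
by split; split; auto.
Qed.
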